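(* Let $X$ be an $r$-ample simplicial complex, let $\mathcal F$ be a finite set of simplexes of $X$, and let $Y$ be the complex obtained from $X$ by removing all simplexes of $\mathcal F$ together with all simplexes of $X$ having a face belonging to $\mathcal F$. Let $k\ge 0$ be an integer. Then $Y$ is $(r-k)$-ample provided that $|\mathcal F|+\dim(\mathcal F)<M'(k)+k$. In particular, $Y$ is $(r-k)$-ample if $|\mathcal F|+\dim(\mathcal F)<2^{\binom{k}{\lfloor k/2\rfloor}}+k$.
   Context: $\dim(\mathcal F)=\sum_{\sigma\in\mathcal F}\dim\sigma$ (total dimension). $M'(k)$ is the number of simplicial complexes (including the empty one) whose vertexes lie in $\{1,\dots,k\}$. For $U\subseteq V(X)$, $X_U$ denotes the induced subcomplex on $U$; $\mathrm{Lk}_X(v)$ is the subcomplex of simplexes $\sigma$ with $v\notin\sigma$ and $\sigma\cup\{v\}\in X$. For an integer $s\ge1$, a nonempty simplicial complex $X$ is $s$-ample if for every $U\subseteq V(X)$ with $|U|\le s$ and every subcomplex $A\subseteq X_U$ (possibly empty) there exists $v\in V(X)\setminus U$ with $\mathrm{Lk}_X(v)\cap X_U=A$.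
   Formalization: The ''in particular'' claim is stated for k ≥ 1, since at k = 0 it fails (X two disjoint edges ab, cd is 1-ample, but deleting the vertex a is not); k < r is assumed throughout because (r−k)-ampleness is defined only for r−k ≥ 1. *)

(* Defs.v *)
From mathcomp Require Import all_boot.
From mathcomp Require Import finmap.
From mathcomp Require Import boolp classical_sets.

Set Implicit Arguments.
Unset Strict Implicit.
Unset Printing Implicit Defensive.

Local Open Scope classical_set_scope.

Section SimplicialComplexes.
Variable T : choiceType.
Implicit Types (X A : set {fset T}) (U s t : {fset T}) (F : {fset {fset T}}).

(* Simplexes are nonempty, so that the empty complex is [set0]; the vertex set
   of X may be infinite. *)
Definition simplicial_complex X :=
  (forall s, X s -> s <> fset0) /\
  (forall s t, X s -> t <> fset0 -> (t `<=` s)%fset -> X t).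

Definition vertices X : set T := [set v | X [fset v]%fset].

Definition induced X U : set {fset T} := [set s | X s /\ (s `<=` U)%fset].

Definition link X (v : T) : set {fset T} :=
  [set s | [/\ s <> fset0, v \notin s & X (v |` s)%fset]].

Definition ample (n : nat) X :=
  [/\ 0 < n, simplicial_complex X, X !=set0 &
    forall (U : {fset T}) (A : set {fset T}),
      [set` U] `<=` vertices X -> #|` U| <= n ->
      simplicial_complex A -> A `<=` induced X U ->
      exists v, [/\ vertices X v, v \notin U & link X v `&` induced X U = A]].

Definition deletion X F : set {fset T} :=
  [set s | X s /\ ~ exists2 t, t \in F & (t `<=` s)%fset].

(* [.-1] does not truncate on (nonempty) simplexes. *)
Definition dim s : nat := #|` s|.-1.

Definition total_dim F : nat := \sum_(s <- F) dim s.

End SimplicialComplexes.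

Definition num_complexes (k : nat) : nat :=
  #|[pred K : {set {fset 'I_k}} | `[< simplicial_complex [set` K] >]]|.

(* Main.v *)
Require Import Defs.
From mathcomp Require Import all_boot finmap boolp classical_sets.

(** Fix [U] and a subcomplex [A] of [Y_U].  The vertices [v] of [X] outside [U]
    with [Lk_X(v) \cap X_U = A] are numerous: choosing them one at a time, [k] of
    them span a full simplex [W], and each of the [M'(k)] complexes [B] on [W]
    is cut out on [W] by the link of one more such vertex, because
    [Lk_X(v) \cap X_(U \cup W)] may be prescribed to be [A \cup B].  Such a [v]
    fails to work in [Y] only if some [t] in [F] satisfies [t \ U = {v}]; hence
    at most [|F|] of these [M'(k) + k] vertices fail. *)

Set Implicit Arguments.
Unset Strict Implicit.
Unset Printing Implicit Defensive.

Local Open Scope classical_set_scope.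

Section Ample.
Variable T : choiceType.
Implicit Types (X A B : set {fset T}) (U W s t : {fset T}) (F : {fset {fset T}}).

Lemma simplicial_complexU A B :
  simplicial_complex A -> simplicial_complex B -> simplicial_complex (A `|` B).
Proof.
move=> [A0 Af] [B0 Bf]; split=> [s [/A0|/B0] //|s t [As|Bs] t0 ts].
  by left; apply: Af ts.
by right; apply: Bf ts.
Qed.

Lemma simplicial_complex_deletion X F :
  simplicial_complex X -> simplicial_complex (deletion X F).
Proof.
move=> [X0 Xf]; split=> [s [/X0] //|s t [Xs nF] t0 ts]; split.
  exact: Xf ts.
by move=> [u uF ut]; apply: nF; exists u => //; apply: fsubset_trans ts.
Qed.

Definition full_simplex W : set {fset T} :=
  [set s | s <> fset0 /\ (s `<=` W)%fset].

Lemma simplicial_complex_full W : simplicial_complex (full_simplex W).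
Proof.
split=> [s [] //|s t [_ sW] t0 ts]; split=> //; exact: fsubset_trans sW.
Qed.

Definition realizes X U A (v : T) :=
  [/\ vertices X v, v \notin U & link X v `&` induced X U = A].

(** * Vertices of [X] with a prescribed link *)

Section Extension.
Variables (n : nat) (X : set {fset T}) (U : {fset T}) (A : set {fset T}).
Hypotheses (amX : ample n X) (UX : [set` U] `<=` vertices X).
Hypotheses (cA : simplicial_complex A) (AX : A `<=` induced X U).

(** Ampleness is applied to the union of [U] and [W], with the union of [A] and [B] as prescribed
    link. Simplexes are nonempty, so none lies in both [U] and [W], and restricting the link to each
    gives back [A] and [B] separately. *)
Lemma extension W B :
    #|` U| + #|` W| <= n -> [disjoint U & W]%fset -> full_simplex W `<=` X ->
    simplicial_complex B -> B `<=` full_simplex W ->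
  exists v, [/\ realizes X U A v, v \notin W &
    forall s, full_simplex W s -> (link X v s <-> B s)].
Proof.
case: amX => _ cX _ ext cardUW UW WX cB BW.
have [] := ext (U `|` W)%fset (A `|` B).
- move=> v /=; rewrite inE => /orP[/UX //|vW]; apply: WX; split.
    by move=> /fsetP /(_ v); rewrite !inE eqxx.
  by rewrite fsub1set.
- by apply: leq_trans cardUW; rewrite cardfsU leq_subr.
- exact: simplicial_complexU.
- move=> s [/AX [Xs sU]|/BW [s0 sW]]; split=> //.
  + exact: fsubset_trans (fsubsetUl _ _).
  + by apply: WX.
  + exact: fsubset_trans (fsubsetUr _ _).
have disj s : s <> fset0 -> (s `<=` U)%fset -> (s `<=` W)%fset -> False.
  move=> s0 sU sW; apply: s0; apply/eqP; rewrite -fsubset0.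
  by move: UW; rewrite -fsetI_eq0 => /eqP <-; rewrite fsubsetI sU.
move=> v [Xv]; rewrite inE negb_or => /andP[vU vW] lk.
exists v; split=> //.
  split=> //; apply/seteqP; split=> s.
    move=> [ls [Xs sU]].
    have : (A `|` B) s.
      by rewrite -lk; split=> //; split=> //; apply: fsubset_trans (fsubsetUl _ _).
    by case=> // /BW [s0 sW]; case: (disj s).
  move=> As; have : (A `|` B) s by left.
  by rewrite -lk => -[ls _]; split=> //; apply: AX.
move=> s [s0 sW]; split=> [ls|Bs].
  have : (A `|` B) s.
    rewrite -lk; split=> //; split; first by apply: WX.
    exact: fsubset_trans (fsubsetUr _ _).
  by case=> // /AX [_ sU]; case: (disj s).
have : (A `|` B) s by right.
by rewrite -lk => -[].
Qed.

(** By induction: a new vertex whose link contains every simplex on [W] is a cone point over [W], so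
    adjoining it gives a larger full simplex. *)
Lemma realizing_simplex k : #|` U| + k <= n ->
  exists W, [/\ #|` W| = k, full_simplex W `<=` X &
    forall w, w \in W -> realizes X U A w].
Proof.
elim: k => [|k IHk] cardU.
  exists fset0; split=> [|s [s0]|w]; rewrite ?cardfs0 ?inE //.
  by rewrite fsubset0 => /eqP.
have {IHk} [|W [Wk WX rW]] := IHk; first by rewrite (leq_trans _ cardU) // leq_add2l.
have UW : [disjoint U & W]%fset.
  by apply/fdisjointP => u uU; apply/negP => /rW [_]; rewrite uU.
have [|v [rv vW lkv]] := extension _ UW WX (simplicial_complex_full W) (@subset_refl _ _).
  by rewrite Wk (leq_trans _ cardU) // leq_add2l.
have [Xv _ _] := rv.
exists (v |` W)%fset; split.
- by rewrite cardfsU1 vW Wk.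
- move=> s [s0 sW].
  have sDW : (s `\ v `<=` W)%fset by rewrite fsubDset.
  have [sv|sv] := boolP (v \in s); last first.
    by apply: WX; split=> //; move: sDW; rewrite mem_fsetD1.
  rewrite -(fsetD1K sv); have [->|/eqP sv0] := eqVneq (s `\ v)%fset fset0.
    by rewrite fsetU0.
  have sWv : full_simplex W (s `\ v)%fset by [].
  by have [_ /(_ sWv) []] := lkv _ sWv.
- by move=> w; rewrite !inE => /orP[/eqP->|/rW].
Qed.

(** A complex on [W] can be read off the link of its vertex, so distinct complexes give distinct
    vertices. These avoid [W], whose own [k] vertices therefore add to the count. *)
Lemma realizing_vertices k : #|` U| + k <= n ->
  exists2 C : {fset T}, #|` C| = num_complexes k + k &
    forall v, v \in C -> realizes X U A v.
Proof.
move=> cardU; have [W [Wk WX rW]] := realizing_simplex cardU.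
have UW : [disjoint U & W]%fset.
  by apply/fdisjointP => u uU; apply/negP => /rW [_]; rewrite uU.
have ekW : k = #|{: W}| by rewrite -cardfE Wk.
(* Numbering the vertices of [W] carries the complexes counted on ['I_k] over to [W]. *)
pose w (i : 'I_k) : T := val (enum_val (cast_ord ekW i)).
have w_inj : injective w.
  by move=> i j /val_inj /enum_val_inj /cast_ord_inj.
pose img (s : {fset 'I_k}) : {fset T} := (w @` s)%fset.
have imgW (s : {fset 'I_k}) : (img s `<=` W)%fset.
  by apply/fsubsetP => _ /imfsetP[i _ ->]; apply: valP.
have img0 (s : {fset 'I_k}) : s <> fset0 -> img s <> fset0.
  case: (fset_0Vmem s) => [-> //|[i si] _ /fsetP /(_ (w i))].
  by rewrite in_imfset // inE.
pose tr (K : {set {fset 'I_k}}) : set {fset T} := img @` [set` K].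
have [f fP] : exists f : {set {fset 'I_k}} -> T,
    forall K : {set {fset 'I_k}},
    simplicial_complex [set` K] ->
    [/\ realizes X U A (f K), f K \notin W &
      forall s, full_simplex W s -> (link X (f K) s <-> tr K s)].
  apply: (fin_all_exists (P := fun (K : {set {fset 'I_k}}) v =>
    simplicial_complex [set` K] ->
    [/\ realizes X U A v, v \notin W &
      forall s, full_simplex W s -> (link X v s <-> tr K s)])) => K.
  (* [f] is total, so a family that is not a complex also needs a value: any element of a simplex of
     [X]. *)
  have [cK|ncK] := pselect (simplicial_complex [set` K]); last first.
    case: amX => _ [X0 _] [s /X0 s0] _.
    by have [//|[v _]] := fset_0Vmem s; exists v.
  case: (cK) => K0 Kf.
  have [|||v ?] := @extension W (tr K) _ UW WX; last by exists v.
  - by rewrite Wk.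
  - split=> [_ [s sK <-]|_ t [s sK <-] t0 ts]; first by apply/img0/K0.
    (* The preimage of [t] in [s] maps back onto [t], so faces of [img s] come from faces of [s]. *)
    pose s' := [fset i in s | w i \in t]%fset.
    have es' : img s' = t.
      apply/fsetP => x; apply/imfsetP/idP => [[i /=]|xt].
        by rewrite !inE => /andP[_ it] ->.
      have /imfsetP[i /= si xE] := fsubsetP ts _ xt.
      by exists i => //; rewrite !inE /= si -xE.
    exists s' => //; apply: Kf sK _ _ => [s'0|].
      by apply: t0; rewrite -es' s'0 /img imfset0.
    by apply/fsubsetP => i; rewrite !inE => /andP[].
  - by move=> _ [s sK <-]; split=> //; apply/img0/K0.
pose P := [pred K : {set {fset 'I_k}} | `[< simplicial_complex [set` K] >]].
have f_inj : {in P &, injective f}.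
  have sub (K1 K2 : {set {fset 'I_k}}) : K1 \in P -> K2 \in P -> f K1 = f K2 -> K1 \subset K2.
    move=> /asboolP c1 /asboolP c2 e; apply/fintype.subsetP => s s1.
    have fs : full_simplex W (img s).
      by split=> //; apply: img0; case: c1 => /(_ s s1).
    have [_ _ /(_ _ fs) l1] := fP _ c1; have [_ _ /(_ _ fs) l2] := fP _ c2.
    have /l1 : tr K1 (img s) by exists s.
    rewrite e => /l2 [s' s'2 es].
    suff <- : s' = s by [].
    apply/fsetP => i; move/fsetP/(_ (w i)): es.
    by rewrite !mem_imfset.
  move=> K1 K2 P1 P2 e; apply/eqP; rewrite finset.eqEsubset !sub //.
exists ([fset f K | K in P]%fset `|` W)%fset; last first.
  move=> v; rewrite inE => /orP[/imfsetP[K /= /asboolP cK ->]|/rW //].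
  by case: (fP _ cK).
rewrite cardfsU (_ : (_ `&` _)%fset = fset0) ?cardfs0 ?subn0.
  by rewrite Wk card_in_imfset //= -cardE.
apply/eqP/fset0Pn => -[v]; rewrite inE => /andP[/imfsetP[K /= /asboolP cK ->]].
by case: (fP _ cK) => _ /negPf->.
Qed.

End Extension.

(** * Passing from [X] to the deletion *)

(** Let [s] be empty or a simplex of [A]; it contains no member of [F]. If adding [v] to [s] creates
    a set containing some [t] in [F], then [v] is in [t] and the rest of [t] lies in [U], which is
    the excluded case. With [s] empty, this says that [v] survives as a vertex. *)
Lemma realizes_deletion X F U A (v : T) :
    simplicial_complex X -> A `<=` induced (deletion X F) U ->
    realizes X U A v -> (forall t, t \in F -> t <> fset0) ->
    (forall t, t \in F -> (t `\` U)%fset <> [fset v]%fset) ->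
  realizes (deletion X F) U A v.
Proof.
move=> [X0 Xf] AY [Xv vU lk] F0 nF.
have inY s : (s `<=` U)%fset -> ~ (exists2 t, t \in F & (t `<=` s)%fset) ->
    ~ exists2 t, t \in F & (t `<=` v |` s)%fset.
  move=> sU ns [t tF tvs]; have [tv|tv] := boolP (v \in t); last first.
    apply: ns; exists t => //; apply/fsubsetP => x xt.
    move: (fsubsetP tvs _ xt); rewrite !inE => /orP[/eqP xv|//].
    by rewrite xv (negPf tv) in xt.
  apply: (nF t tF); apply/fsetP => x; rewrite !inE.
  apply/andP/eqP => [[xU /(fsubsetP tvs)]|->//].
  by rewrite !inE => /orP[/eqP//|/(fsubsetP sU)]; rewrite (negPf xU).
split=> //.
  split=> //; rewrite -[[fset v]%fset]fsetU0; apply: inY => [|[t tF]].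
    exact: fsub0set.
  by rewrite fsubset0 => /eqP /(F0 t tF).
apply/seteqP; split=> s.
  move=> [[s0 vs [Xvs _]] [[Xs _] sU]]; rewrite -lk; split=> //.
move=> As; have [[Xs ns] sU] := AY _ As.
move: As; rewrite -{1}lk => -[[s0 vs Xvs] _]; split=> //.
by split=> //; split=> //; apply: inY.
Qed.

Lemma ample_deletion X F (r k : nat) : k < r -> ample r X ->
    (forall s, s \in F -> X s) -> #|` F| < num_complexes k + k ->
  ample (r - k) (deletion X F).
Proof.
move=> ltkr amX FX cardF; have [_ cX _ _] := amX.
have main U A : [set` U] `<=` vertices (deletion X F) -> #|` U| <= r - k ->
    simplicial_complex A -> A `<=` induced (deletion X F) U ->
    exists v, realizes (deletion X F) U A v.
  move=> UY cardU cA AY.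
  have UX : [set` U] `<=` vertices X by move=> u /UY [].
  have AX : A `<=` induced X U by move=> s /AY [[]].
  have cardUk : #|` U| + k <= r by rewrite addnC -leq_subRL // ltnW.
  have [C Ck rC] := realizing_vertices amX UX cA AX cardUk.
  have F0 t : t \in F -> t <> fset0 by move=> /FX; case: cX => /(_ t).
  (* If no vertex of [C] works, each singleton of a vertex of [C] is the difference of some [t] in
     [F] and [U], so [C] is no larger than [F]. *)
  apply: contrapT => noV; move: cardF; rewrite -Ck ltnNge => /negP; apply.
  have <- : #|` [fset [fset v] | v in C]%fset| = #|` C|.
    exact: (card_imfset _ _ (@fset1_inj T)).
  have leF : #|` [fset (t `\` U) | t in F]%fset| <= #|` F|.
    exact: leq_imfset_card.
  apply: leq_trans leF.
  apply/fsubset_leq_card/fsubsetP => _ /imfsetP[v /= vC ->].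
  apply: contrapT => vF; apply: noV; exists v.
  apply: realizes_deletion => //; first exact: rC.
  by move=> t tF tv; apply: vF; apply/imfsetP; exists t.
split=> //; first by rewrite subn_gt0.
- exact: simplicial_complex_deletion.
(* Empty [U] and [A] yield a vertex, so the deletion is nonempty. *)
- have [||||v [Yv _ _]] := main fset0 set0; last by exists [fset v]%fset.
  + by move=> v /=; rewrite inE.
  + by rewrite cardfs0.
  + by split.
  + by [].
Qed.

End Ample.

(** * Counting complexes on [k] vertices, and the conclusion *)

(* A family of [m]-element sets is recovered from the complex it generates.  We
   take [m = uphalf k] because [k./2 = 0] when [k = 1], and the empty set is not
   a simplex. *)
Lemma num_complexes_ge k : 0 < k -> 2 ^ 'C(k, k./2) <= num_complexes k.
Proof.
move=> k0; pose m := uphalf k.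
have m0 : 0 < m by rewrite uphalf_gt0.
have -> : 'C(k, k./2) = 'C(k, m).
  rewrite -[in RHS]bin_sub; last by rewrite leq_uphalf_double -addnn leq_addr.
  by rewrite -[X in X - _]odd_double_half /m uphalf_half -addnn addnA addKn.
(* The power of two counts the families of [m]-element subsets of ['I_k]. *)
rewrite -{1}[k]card_ord -card_draws -card_powerset.
pose G (S : {set {set 'I_k}}) : {set {fset 'I_k}} := [set s |
  (s != fset0) && [exists t in S, [set x in s] \subset t]]%SET.
have GP S : simplicial_complex [set` G S].
  split=> [s /=|s t /=]; rewrite inE; first by case/andP=> /eqP.
  move=> /andP[_ /exists_inP[u uS su]] /eqP t0 ts; rewrite inE; apply/andP; split=> //.
  apply/exists_inP; exists u => //; apply: fintype.subset_trans su.
  by apply/fintype.subsetP => x; rewrite !inE; apply: (fsubsetP ts).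
set D := powerset _.
have G_inj : {in D &, injective G}.
  have sub (S1 S2 : {set {set 'I_k}}) : S1 \in D -> S2 \in D -> G S1 = G S2 -> S1 \subset S2.
    rewrite !inE => /fintype.subsetP D1 /fintype.subsetP D2 e.
    apply/fintype.subsetP => t t1.
    have /[!inE] /eqP tm := D1 _ t1.
    (* [t] is a simplex of [G S1], hence of [G S2], so it lies in some [u] of [S2]; both have [m]
       elements and thus coincide. *)
    have : [fset x in t]%fset \in G S1.
      rewrite inE; apply/andP; split; last first.
        apply/exists_inP; exists t => //.
        by apply/fintype.subsetP => x; rewrite !inE.
      have /card_gt0P[x xt] : 0 < #|t| by rewrite tm.
      by apply/fset0Pn; exists x; rewrite !inE.
    rewrite e inE => /andP[_ /exists_inP[u u2 /fintype.subsetP tu]].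
    have {}tu : t \subset u.
      by apply/fintype.subsetP => x xt; apply: tu; rewrite !inE.
    have /[!inE] /eqP um := D2 _ u2.
    suff /eqP-> : t == u by [].
    by rewrite eqEcard tu tm um leqnn.
  by move=> S1 S2 d1 d2 e; apply/eqP; rewrite finset.eqEsubset !sub.
rewrite -(card_in_imset G_inj); apply/subset_leq_card/fintype.subsetP.
by move=> _ /imsetP[S _ ->]; apply/asboolP.
Qed.

(** [k < r] makes [r - k] positive, as [ample] demands. The second bound is derived from the first
    for [0 < k]: at [k = 0] its power of two is 2, whereas the empty complex is the only one on no
    vertices and [num_complexes 0] is 1. *)
Theorem theorem5p1 (T : choiceType) (X : set {fset T}) (F : {fset {fset T}})
    (r k : nat) (ltkr : k < r) (amX : ample r X)
    (FX : forall s, s \in F -> X s) :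
  (#|` F| + total_dim F < num_complexes k + k ->
     ample (r - k) (deletion X F)) /\
  (0 < k -> #|` F| + total_dim F < 2 ^ 'C(k, k./2) + k ->
     ample (r - k) (deletion X F)).
Proof.
have main : #|` F| + total_dim F < num_complexes k + k ->
    ample (r - k) (deletion X F).
  by move=> ltF; apply: ample_deletion => //; apply: leq_ltn_trans ltF; apply: leq_addr.
split=> // k0 ltF; apply: main; apply: leq_trans ltF _.
by rewrite leq_add2r num_complexes_ge.
Qed.
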